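(* Let $p,q$ be prime numbers with $q-p=2$, and consider the following two systems of Diophantine equations in integers $X,Y,S,T$: $$\text{(I)}\quad X^2-pY^2=S^2,\qquad X^2-qY^2=-T^2;$$ $$\text{(II)}\quad X^2-pY^2=2S^2,\qquad X^2-qY^2=-2T^2.$$ If $p\equiv 5\pmod 8$, then neither (I) nor (II) has a primary solution. Furthermore, the only integer solution $(X,Y,S,T)$ of each of (I) and (II) is $(0,0,0,0)$.
   Context: A primary solution of (I) (or of (II)) is an integer solution $(X,Y,S,T)\in\mathbf{Z}^4$ with $\gcd(X,Y)=1$ and $XY\neq 0$. *)

(* Defs.v *)
From mathcomp Require Import all_boot all_order all_algebra.

Set Implicit Arguments.
Unset Strict Implicit.
Unset Printing Implicit Defensive.

Import Order.TTheory GRing.Theory Num.Theory.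
Local Open Scope ring_scope.

Definition systemI (p q : nat) (X Y S T : int) : Prop :=
  X ^+ 2 - p%:Z * Y ^+ 2 = S ^+ 2 /\ X ^+ 2 - q%:Z * Y ^+ 2 = - T ^+ 2.

Definition systemII (p q : nat) (X Y S T : int) : Prop :=
  X ^+ 2 - p%:Z * Y ^+ 2 = 2 * S ^+ 2 /\
  X ^+ 2 - q%:Z * Y ^+ 2 = - 2 * T ^+ 2.

Definition primary_solution (sys : int -> int -> int -> int -> Prop)
    (X Y S T : int) : Prop :=
  [/\ sys X Y S T, gcdz X Y = 1 & X * Y <> 0].

(* Main.v *)
Require Import Defs.
From mathcomp Require Import all_boot all_order all_algebra.
From mathcomp Require Import zify ring lra.

Set Implicit Arguments.
Unset Strict Implicit.
Unset Printing Implicit Defensive.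

Import Order.TTheory GRing.Theory Num.Theory.
Local Open Scope ring_scope.

(** One equation of each system already has no nonzero integer solution, for a
    reason at the prime 2.  Since p is 5 mod 8 and q = p + 2, we have q = 3
    mod 4.  In (I), the second equation reads X^2 + T^2 = q Y^2; modulo 4 it
    says that the sum of the three squares X^2 + T^2 + Y^2 vanishes, so that X,
    T and Y are all even.  In (II), the first equation X^2 - p Y^2 = 2 S^2
    forces X and Y to have the same parity; if both were odd, then 2 S^2 would
    be 4 modulo 8, that is, S^2 would be 2 modulo 4; hence X and Y are even,
    and then so is S.  Both equations are homogeneous, so a solution can be
    halved again and again, and only the zero solution survives
    ([halving_descent]).  The fourth unknown then vanishes by the other
    equation, and a primary solution, for which X Y <> 0, cannot exist. *)

(** Infinite descent: halving strictly decreases |x| + |y| + |z| unless this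
    sum is 0. *)
Lemma halving_descent (P : int -> int -> int -> Prop) :
  (forall x y z, P x y z -> exists x' y' z',
     [/\ x = 2 * x', y = 2 * y', z = 2 * z' & P x' y' z']) ->
  forall x y z, P x y z -> [/\ x = 0, y = 0 & z = 0].
Proof.
move=> halve x y z.
have [n] := ubnP (`|x| + `|y| + `|z|)%N.
elim: n x y z => // n IHn x y z lt_n /halve[x' [y' [z' [xE yE zE Pxyz']]]].
have [sum0|sum_gt0] := posnP (`|x| + `|y| + `|z|)%N; first by split; lia.
have [|x'0 y'0 z'0] := IHn x' y' z' _ Pxyz'; first by lia.
by rewrite xE yE zE x'0 y'0 z'0 mulr0.
Qed.

Lemma int_parity (x : int) : exists y, x = 2 * y \/ x = 2 * y + 1.
Proof. by exists (x %/ 2)%Z; lia. Qed.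

Lemma even_mul_succ (x : int) : exists y, x * x + x = 2 * y.
Proof.
have [y [->|->]] := int_parity x; first by exists (2 * (y * y) + y); ring.
by exists (2 * (y * y) + 3 * y + 1); ring.
Qed.

(** Modulo 4 a square is 0 or 1 and [q] is -1, so the equation makes a sum of
    three squares vanish modulo 4, which forces all three to be even. *)
Lemma sum_sqr_eq_3mod4 (q x y t : int) :
  (q = 3 %[mod 4])%Z -> x ^+ 2 + t ^+ 2 = q * y ^+ 2 ->
  [/\ x = 0, y = 0 & t = 0].
Proof.
move=> q_mod4; have [k ->] : exists k, q = 4 * k + 3.
  by exists (q %/ 4)%Z; lia.
move: x y t; apply: halving_descent => x y t eq_xyt.
have [a xE] := int_parity x; have [b yE] := int_parity y.
have [c tE] := int_parity t; exists a, b, c.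
case: xE yE tE eq_xyt => -> [] -> [] -> eq_xyt;
  try by exfalso; rewrite !expr2 in eq_xyt; lia.
split=> //; rewrite !expr2 in eq_xyt *; lia.
Qed.

(** With [x] and [y] both odd, [x ^+ 2 - p * y ^+ 2] is 4 modulo 8, which is
    not twice a square; the other parities of [x], [y] and [s] are excluded
    modulo 4, except that all three are even. *)
Lemma sqr_sub_eq_double_5mod8 (p x y s : int) :
  (p = 5 %[mod 8])%Z -> x ^+ 2 - p * y ^+ 2 = 2 * s ^+ 2 ->
  [/\ x = 0, y = 0 & s = 0].
Proof.
move=> p_mod8; have [k ->] : exists k, p = 8 * k + 5.
  by exists (p %/ 8)%Z; lia.
move: x y s; apply: halving_descent => x y s eq_xys.
have [a xE] := int_parity x; have [b yE] := int_parity y.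
have [c sE] := int_parity s; exists a, b, c.
(* An odd square (2a+1)^2 = 4(a^2+a) + 1 is 1 modulo 8, not just modulo 4,
   because a^2+a is even. *)
have [a' a'E] := even_mul_succ a; have [b' b'E] := even_mul_succ b.
case: xE yE sE eq_xys => -> [] -> [] -> eq_xys;
  try by exfalso; rewrite !expr2 in eq_xys; lia.
split=> //; rewrite !expr2 in eq_xys *; lia.
Qed.

Theorem theorem2 (p q : nat) (p_prime : prime p) (q_prime : prime q)
    (twin : q%:Z - p%:Z = 2) (p_mod8 : (p = 5 %[mod 8])%N) :
  [/\ ~ (exists X Y S T : int, primary_solution (systemI p q) X Y S T),
      ~ (exists X Y S T : int, primary_solution (systemII p q) X Y S T),
      (forall X Y S T : int,
         systemI p q X Y S T <-> (X, Y, S, T) = (0, 0, 0, 0)) &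
      (forall X Y S T : int,
         systemII p q X Y S T <-> (X, Y, S, T) = (0, 0, 0, 0))].
Proof.
have p_mod8Z : (p%:Z = 5 %[mod 8])%Z by lia.
have q_mod4Z : (q%:Z = 3 %[mod 4])%Z by lia.
have trivI X Y S T : systemI p q X Y S T -> (X, Y, S, T) = (0, 0, 0, 0).
  move=> [eqS eqT].
  have [|X0 Y0 T0] := @sum_sqr_eq_3mod4 q%:Z X Y T q_mod4Z; first by lra.
  move: eqS; rewrite X0 Y0 T0 expr0n mulr0 subr0 => /esym/eqP.
  by rewrite sqrf_eq0 => /eqP->.
have trivII X Y S T : systemII p q X Y S T -> (X, Y, S, T) = (0, 0, 0, 0).
  move=> [eqS eqT].
  have [X0 Y0 S0] := sqr_sub_eq_double_5mod8 p_mod8Z eqS.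
  move: eqT; rewrite X0 Y0 S0 expr0n mulr0 subr0 => /esym/eqP.
  by rewrite mulf_eq0 sqrf_eq0 => /eqP->.
split.
- by move=> [X [Y [S [T [/trivI[-> _ _ _] _ []]]]]]; rewrite mul0r.
- by move=> [X [Y [S [T [/trivII[-> _ _ _] _ []]]]]]; rewrite mul0r.
- move=> X Y S T; split=> [/trivI //|[-> -> -> ->]].
  by rewrite /systemI expr0n !mulr0 subr0 oppr0.
- move=> X Y S T; split=> [/trivII //|[-> -> -> ->]].
  by rewrite /systemII expr0n !mulr0 subr0.
Qed.
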